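(* $$\frac{2}{2\zeta(5)-2\zeta(3)+1}=\mathrm{CF}\left[n^5+(n+1)^5+6\{n^3+(n+1)^3\}-4(2n+1),\,-n^{10}\right].$$
   Context: For sequences $(a_n)_{n\ge0}$, $(b_n)_{n\ge1}$, $\mathrm{CF}[a_n,b_n]$ denotes the continued fraction $a_0+\cfrac{b_1}{a_1+\cfrac{b_2}{a_2+\ddots}}$, whose value is $\lim_{n\to\infty}A_n/B_n$, where $A_0=1$, $A_1=a_0$, $B_0=0$, $B_1=1$, and $A_{n+1}=a_nA_n+b_nA_{n-1}$, $B_{n+1}=a_nB_n+b_nB_{n-1}$ for $n\ge1$. $\zeta$ is the Riemann zeta function. *)

(* Defs.v *)
From Stdlib Require Import Reals.
From Coquelicot Require Import Coquelicot.
Open Scope R_scope.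

(* The Riemann zeta function restricted to real s > 1, as its Dirichlet series.
   For s <= 1 the series diverges and the value is meaningless. *)
Definition zeta (s : R) : R := Series (fun n : nat => / Rpower (INR (S n)) s).

(* [CF_num a b n / CF_den a b n] is the continued fraction truncated after the
   partial denominator a_(n-1); the value b 0 is never used. *)
Fixpoint CF_num (a b : nat -> R) (n : nat) : R :=
  match n with
  | O => 1
  | S m => match m with
           | O => a O
           | S k => a m * CF_num a b m + b m * CF_num a b k
           end
  end.

Fixpoint CF_den (a b : nat -> R) (n : nat) : R :=
  match n with
  | O => 0
  | S m => match m with
           | O => 1
           | S k => a m * CF_den a b m + b m * CF_den a b k
           end
  end.

(* Division by 0 is total in R, so the definedness of the convergents from some
   rank on has to be required explicitly (CF_den a b 0 is always 0). *)
Definition is_CF (a b : nat -> R) (l : R) : Prop :=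
  eventually (fun n => CF_den a b n <> 0) /\
  is_lim_seq (fun n => CF_num a b n / CF_den a b n) l.

(* Main.v *)
Require Import Defs.
From Stdlib Require Import Reals Factorial Lra Lia.
From Coquelicot Require Import Coquelicot.
Open Scope R_scope.

(** Writing [A_n = n!^5 v_n] turns the recurrence into
    [(n+1)^5 (v_(n+1) - v_n) - n^5 (v_n - v_(n-1)) = 2 (2n+1) (3n^2+3n+1) v_n],
    which is solved by the polynomial [v_n = n^2+n+1]; this is the sequence of
    numerators. By the Casoratian, the denominators are given by
    [B_n / A_n = sum_(k=1..n) 1 / (k^5 (k^4+k^2+1))], because
    [v_k v_(k-1) = k^4+k^2+1]. Finally
    [1 / (k^5 (k^4+k^2+1)) = 1/k^5 - 1/k^3 + k / (k^4+k^2+1)], and the last term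
    is [(1/v_(k-1) - 1/v_k) / 2], which telescopes to the sum [1/2]. *)

Lemma is_series_telescope (u : nat -> R) :
  is_lim_seq u 0 -> is_series (fun n => u n - u (S n)) (u O).
Proof.
intros Hu.
change (is_lim_seq (sum_n (fun n => u n - u (S n))) (u O)).
apply (is_lim_seq_ext (fun n => u O - u (S n))).
- intros n; induction n as [|n IH].
  + now rewrite sum_O.
  + rewrite sum_Sn, <- IH; unfold plus; simpl; ring.
- replace (Finite (u O)) with (Finite (u O - 0)) by (f_equal; ring).
  apply is_lim_seq_minus'; [apply is_lim_seq_const|].
  now apply -> is_lim_seq_incr_1.
Qed.

Lemma is_lim_seq_inv_succ : is_lim_seq (fun n => / INR (S n)) 0.
Proof.
apply (is_lim_seq_inv (fun n => INR (S n)) p_infty).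
- apply -> is_lim_seq_incr_1; apply is_lim_seq_INR.
- discriminate.
Qed.

Lemma INR_succ_ge1 (n : nat) : 1 <= INR (S n).
Proof. rewrite S_INR; generalize (pos_INR n); lra. Qed.

(** With x = n+1 >= 1, 1/x^s <= 1/x^2 <= 2/(x(x+1)) = 2/x - 2/(x+1), so the series is dominated by a
    telescoping one. The factor 2 pays for x+1 <= 2x. *)
Lemma ex_series_inv_pow_succ (s : nat) :
  (2 <= s)%nat -> ex_series (fun n => / INR (S n) ^ s).
Proof.
intros Hs.
apply (ex_series_le (V := R_CompleteNormedModule) _
         (fun n => 2 * / INR (S n) - 2 * / INR (S (S n)))).
- intros n; unfold norm; simpl norm; unfold abs; cbn -[INR pow].
  generalize (INR_succ_ge1 n); rewrite (S_INR (S n)).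
  set (x := INR (S n)); intros Hx.
  assert (Hp : 0 < x ^ 2) by (apply pow_lt; lra).
  rewrite Rabs_pos_eq by (left; apply Rinv_0_lt_compat, pow_lt; lra).
  apply Rle_trans with (/ x ^ 2).
  + apply Rinv_le_contravar; [exact Hp | now apply Rle_pow].
  + replace (2 * / x - 2 * / (x + 1)) with (/ x ^ 2 + (x - 1) / (x ^ 2 * (x + 1)))
      by (field; lra).
    assert (0 <= (x - 1) / (x ^ 2 * (x + 1))); [|lra].
    apply Rdiv_le_0_compat; [lra | apply Rmult_lt_0_compat; lra].
- exists (2 * / INR 1).
  apply (is_series_telescope (fun n => 2 * / INR (S n))).
  replace (Finite 0) with (Rbar_mult 2 0) by (simpl; f_equal; ring).
  apply is_lim_seq_scal_l, is_lim_seq_inv_succ.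
Qed.

Lemma is_series_zeta (s : nat) :
  (2 <= s)%nat -> is_series (fun n => / INR (S n) ^ s) (zeta (INR s)).
Proof.
intros Hs; unfold zeta.
rewrite (Series_ext _ (fun n => / INR (S n) ^ s)).
- now apply Series_correct, ex_series_inv_pow_succ.
- intros n; rewrite Rpower_pow; [reflexivity|].
  generalize (INR_succ_ge1 n); lra.
Qed.

(** The index is shifted: [weight n] is the term k = n+1, so [sum_n weight n] runs over k =
    1..n+1. *)
Definition weight (n : nat) : R :=
  / (INR (S n) ^ 5 * (INR (S n) ^ 4 + INR (S n) ^ 2 + 1)).

Lemma weight_pos (n : nat) : 0 < weight n.
Proof.
generalize (INR_succ_ge1 n); intros Hx; unfold weight.
apply Rinv_0_lt_compat, Rmult_lt_0_compat.
- apply pow_lt; lra.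
- assert (0 < INR (S n) ^ 4) by (apply pow_lt; lra).
  assert (0 < INR (S n) ^ 2) by (apply pow_lt; lra).
  lra.
Qed.

Lemma sum_weight_pos (n : nat) : 0 < sum_n weight n.
Proof.
induction n as [|n IH].
- rewrite sum_O; apply weight_pos.
- rewrite sum_Sn; apply Rplus_lt_0_compat; [exact IH | apply weight_pos].
Qed.

Lemma is_series_weight : is_series weight (zeta 5 - zeta 3 + 1 / 2).
Proof.
(* Here [u n] is 1/(2 v_n): its successive differences are k/(k^4+k^2+1) with k = n+1, and [u O]
   supplies the 1/2. *)
set (u := fun n => / (2 * (INR n ^ 2 + INR n + 1))).
assert (Hu : is_lim_seq u 0).
{ apply (is_lim_seq_le_le (fun _ => 0) _ (fun n => / INR (S n))).
  - intros n; unfold u; rewrite S_INR; generalize (pos_INR n); intros Hn.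
    split.
    + left; apply Rinv_0_lt_compat; nra.
    + apply Rinv_le_contravar; nra.
  - apply is_lim_seq_const.
  - apply is_lim_seq_inv_succ. }
apply is_series_telescope in Hu.
assert (H5 := is_series_zeta 5 ltac:(lia)).
assert (H3 := is_series_zeta 3 ltac:(lia)).
replace (INR 5) with 5 in H5 by (simpl; ring).
replace (INR 3) with 3 in H3 by (simpl; ring).
assert (H := is_series_plus _ _ _ _ (is_series_minus _ _ _ _ H5 H3) Hu).
replace (zeta 5 - zeta 3 + 1 / 2)
  with (plus (plus (zeta 5) (opp (zeta 3))) (u O)).
- revert H; apply is_series_ext; intros n.
  unfold u, weight, plus, opp; cbn -[INR pow].
  generalize (INR_succ_ge1 n); rewrite S_INR; intros Hn.
  field; repeat split; nra.
- unfold u, plus, opp; simpl; field.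
Qed.

(** Notations keep these coefficients syntactically equal to the functions in the final statement,
    so the lemmas below rewrite there without unfolding. *)
Notation cf_a := (fun n : nat =>
  INR n ^ 5 + (INR n + 1) ^ 5 + 6 * (INR n ^ 3 + (INR n + 1) ^ 3)
  - 4 * (2 * INR n + 1)).
Notation cf_b := (fun n : nat => - INR n ^ 10).

Lemma CF_num_SS (a b : nat -> R) (n : nat) :
  CF_num a b (S (S n)) = a (S n) * CF_num a b (S n) + b (S n) * CF_num a b n.
Proof. reflexivity. Qed.

Lemma CF_den_SS (a b : nat -> R) (n : nat) :
  CF_den a b (S (S n)) = a (S n) * CF_den a b (S n) + b (S n) * CF_den a b n.
Proof. reflexivity. Qed.

Lemma INR_fact_S (n : nat) : INR (fact (S n)) = (INR n + 1) * INR (fact n).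
Proof. now rewrite fact_simpl, mult_INR, S_INR. Qed.

Lemma CF_num_zeta (n : nat) :
  CF_num cf_a cf_b n = INR (fact n) ^ 5 * (INR n ^ 2 + INR n + 1).
Proof.
(* The recurrence has order two, so the induction carries two consecutive indices. *)
cut (CF_num cf_a cf_b n = INR (fact n) ^ 5 * (INR n ^ 2 + INR n + 1) /\
     CF_num cf_a cf_b (S n)
     = INR (fact (S n)) ^ 5 * (INR (S n) ^ 2 + INR (S n) + 1)); [tauto|].
induction n as [|n [IH0 IH1]].
- split; simpl; ring.
- split; [exact IH1|].
  rewrite CF_num_SS, IH0, IH1, !INR_fact_S, !S_INR; ring.
Qed.

Lemma CF_num_zeta_pos (n : nat) : 0 < CF_num cf_a cf_b n.
Proof.
rewrite CF_num_zeta; apply Rmult_lt_0_compat.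
- apply pow_lt, INR_fact_lt_0.
- generalize (pos_INR n); nra.
Qed.

(** The index starts at 1 because [sum_n] always contains its first term, whereas the denominator 0
    at index 0 corresponds to the empty sum. *)
Lemma CF_den_zeta (n : nat) :
  CF_den cf_a cf_b (S n) = CF_num cf_a cf_b (S n) * sum_n weight n.
Proof.
cut (CF_den cf_a cf_b (S n)
     = CF_num cf_a cf_b (S n) * sum_n weight n /\
     CF_den cf_a cf_b (S (S n))
     = CF_num cf_a cf_b (S (S n)) * sum_n weight (S n)); [tauto|].
assert (H0 : forall m, 0 < (INR m + 1) ^ 4 + (INR m + 1) ^ 2 + 1).
{ intros m; generalize (pos_INR m); intros Hm.
  assert (0 < (INR m + 1) ^ 4) by (apply pow_lt; lra).
  assert (0 < (INR m + 1) ^ 2) by (apply pow_lt; lra).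
  lra. }
induction n as [|n [IH0 IH1]].
- rewrite sum_Sn, sum_O; unfold plus, weight; simpl; split; field.
- split; [exact IH1|].
  (* With m = n+2, the numerator recurrence cancels the common partial sum, and the identity amounts
     to m^10 A_(m-1) [weight (m-1)] = A_(m+1) [weight m]; both sides equal m!^5 / v_m. *)
  rewrite CF_den_SS, IH0, IH1.
  rewrite (sum_Sn _ (S n)), (sum_Sn _ n).
  rewrite !CF_num_zeta, !INR_fact_S.
  unfold plus, weight; cbn -[INR pow fact sum_n]; rewrite !S_INR.
  assert (H2 := H0 (S n)); assert (H3 := H0 (S (S n))).
  rewrite !S_INR in H2; rewrite !S_INR in H3.
  assert (Hn := pos_INR n).
  field; repeat split; lra.
Qed.

Theorem theorem3p5 :
  is_CF
    (fun n : nat =>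
       INR n ^ 5 + (INR n + 1) ^ 5 + 6 * (INR n ^ 3 + (INR n + 1) ^ 3)
       - 4 * (2 * INR n + 1))
    (fun n : nat => - INR n ^ 10)
    (2 / (2 * zeta 5 - 2 * zeta 3 + 1)).
Proof.
(* The partial sums increase, so the limit is at least the first one; its positivity allows the
   limit to be inverted. *)
assert (Hlim : 0 < zeta 5 - zeta 3 + 1 / 2).
{ apply Rlt_le_trans with (sum_n weight 0); [apply sum_weight_pos|].
  apply (is_lim_seq_incr_compare (sum_n weight)); [exact is_series_weight|].
  intros n; rewrite sum_Sn; unfold plus; simpl.
  generalize (weight_pos (S n)); lra. }
split.
- exists 1%nat; intros [|n] Hn; [lia|].
  rewrite CF_den_zeta.
  apply Rgt_not_eq, Rmult_lt_0_compat;
    [apply CF_num_zeta_pos | apply sum_weight_pos].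
(* After a shift past index 0, the numerators cancel and each convergent is the inverse of a partial
   sum. *)
- apply is_lim_seq_incr_1.
  apply (is_lim_seq_ext (fun n => / sum_n weight n)).
  + intros n; rewrite CF_den_zeta.
    generalize (CF_num_zeta_pos (S n)), (sum_weight_pos n).
    intros; field; split; lra.
  + replace (2 / (2 * zeta 5 - 2 * zeta 3 + 1))
      with (/ (zeta 5 - zeta 3 + 1 / 2)) by (field; lra).
    apply (is_lim_seq_inv (sum_n weight) (zeta 5 - zeta 3 + 1 / 2)).
    * exact is_series_weight.
    * intros H; injection H; lra.
Qed.
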